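(* Let $\mathbb{E}$ be a separable Banach space and let $\mu\in\mathcal{P}(\mathbb{E})$ be a weakly stable distribution with $\mu \neq \delta_0$. A probability measure $\lambda$ on $\mathbb{R}$ is $\mu$-weakly stable if and only if the measure $\lambda \circ \mu$ is strictly stable in the usual sense; thus, in this case, there exists $\alpha \in (0, 2]$ such that $\lambda \circ \mu$ is strictly $\alpha$-stable.
   Context: $\mathcal{P}(\mathbb{E})$ is the set of all Borel probability measures on $\mathbb{E}$, and $\mathcal{P} = \mathcal{P}(\mathbb{R})$. For $a \in \mathbb{R}$ and a probability measure $\nu$, $T_a\nu$ is the distribution of $aX$ when $X$ has distribution $\nu$ (so $T_0\nu=\delta_0$). For $\mu \in \mathcal{P}(\mathbb{E})$ and $\lambda \in \mathcal{P}$, the scale mixture is $(\mu \circ \lambda)(A) = \int_{\mathbb{R}} T_s\mu(A)\,\lambda(ds)$ for Borel $A \subset \mathbb{E}$, also written $\lambda\circ\mu$; it is the distribution of $\mathbf{X}\Theta$, where $\mathbf{X}\sim\mu$ and $\Theta\sim\lambda$ are independent. The symbol $*$ denotes ordinary convolution. For $\lambda \in \mathcal{P}$, $|\lambda|$ denotes the distribution of $|\Theta|$ when $\Theta \sim \lambda$. A measure $\mu \in \mathcal{P}(\mathbb{E})$ is weakly stable if for all $\lambda_1,\lambda_2 \in \mathcal{P}$ there exists $\lambda \in \mathcal{P}$ such that $(\lambda_1\circ\mu)*(\lambda_2\circ\mu)=\lambda\circ\mu$. A measure $\mu$ is symmetric if $T_{-1}\mu=\mu$. If $\mu\ne\delta_0$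 is weakly stable and not symmetric, the measure $\lambda$ is uniquely determined; if $\mu\neq\delta_0$ is weakly stable and symmetric, $|\lambda|$ is uniquely determined. Generalized convolution: let $\mu \neq \delta_0$ be weakly stable and $\lambda_1,\lambda_2\in\mathcal{P}$. If $\lambda\in\mathcal{P}$ satisfies $(\lambda_1\circ\mu)*(\lambda_2\circ\mu)=\lambda\circ\mu$, then $\lambda_1\oplus_\mu\lambda_2 := \lambda$ if $\mu$ is not symmetric, and $\lambda_1\oplus_\mu\lambda_2 := |\lambda|$ if $\mu$ is symmetric. A probability measure $\lambda$ on $\mathbb{R}$ is $\mu$-weakly stable if for all $a,b>0$ there exists $c>0$ such that $T_a\lambda\oplus_\mu T_b\lambda=T_c\lambda$; when $\mu$ is symmetric, measures on $\mathbb{R}$ are by convention replaced by their images under $x\mapsto|x|$, so the equality then reads $T_a\lambda\oplus_\mu T_b\lambda=|T_c\lambda|$. Equivalently, for $\Theta,\Theta'$ with distribution $\lambda$ and $\mathbf{X},\mathbf{X}'$ with distribution $\mu$, all independent, for all $a,b>0$ there is $c>0$ such that $(a\Theta)\mathbf{X}+(b\Theta')\mathbf{X}'$ has the same distribution as $(c\Theta)\mathbf{X}$. A probability measure $\nu$ on $\mathbb{E}$ is strictly stable if for all $a,b>0$ there exists $c>0$ with $T_a\nu*T_b\nu=T_c\nu$; it is strictly $\alpha$-stable if this holds with $c=(a^\alpha+b^\alpha)^{1/\alpha}$ for all $a,b>0$. *)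

(* Defs.v *)
From HB Require Import structures.
From mathcomp Require Import all_boot all_order all_algebra.
From mathcomp Require Import all_classical all_reals all_analysis.
From mathcomp Require Import measurable_realfun giry.
Set Implicit Arguments.
Unset Strict Implicit.
Unset Printing Implicit Defensive.

Import Order.TTheory GRing.Theory Num.Theory.
Import numFieldNormedType.Exports.

Local Open Scope classical_set_scope.
Local Open Scope ring_scope.

Definition separable (T : topologicalType) :=
  exists2 D : set T, countable D & dense D.

HB.mixin Record isSeparable T of Topological T := {
  separable_subproof : separable T
}.

#[short(type="separableBanachType")]
HB.structure Definition SeparableBanach (K : numFieldType) :=
  {E of CompleteNormedModule K E & isSeparable E}.

Definition borel (T : ptopologicalType) := g_sigma_algebraType (@open T).

Section joint_measurability.
Context {R : realType}.

Lemma separable_real : separable R.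
Proof.
exists (@ratr R @` setT); last exact: dense_rat.
exact/card_le_trans/(countableP [set: rat])/card_image_le.
Qed.

Lemma countable_bigcup_measurable d (T : measurableType d) (I : Type)
    (D : set I) (F : I -> set T) : countable D ->
  (forall i, D i -> measurable (F i)) -> measurable (\bigcup_(i in D) F i).
Proof.
move=> /pfcard_geP[->|]; first by rewrite bigcup_set0.
case=> f mF.
have <- : \bigcup_n F (f n) = \bigcup_(i in D) F i.
  apply/seteqP; split => [x [n _ Fx]|x [i Di Fx]].
    by exists (f n) => //; exact: funS.
  by have [n _ fn] := @surj _ _ _ _ f i Di; exists n => //; rewrite fn.
by apply: bigcupT_measurable => n; apply: mF; exact: funS.
Qed.

(* Separability is what makes addition and scaling jointly measurable for the
   product of the Borel sigma-algebras, so that convolutions and scale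
   mixtures of Borel probability measures are again such measures. *)
Lemma open_prodE (S T : pseudoMetricType R) (O : set (S * T)) :
  separable S -> separable T -> open O ->
  exists2 D : set (S * T * nat), countable D & exists U : S * T * nat -> set S,
    exists2 V : S * T * nat -> set T,
      (forall i, open (U i) /\ open (V i)) &
      O = \bigcup_(i in D) (U i `*` V i).
Proof.
move=> [A cA dA] [B cB dB] oO.
pose U (i : S * T * nat) := (ball i.1.1 i.2.+1%:R^-1)°.
pose V (i : S * T * nat) := (ball i.1.2 i.2.+1%:R^-1)°.
exists ((A `*` B `*` setT) `&` [set i | U i `*` V i `<=` O]).
  apply: (@sub_countable _ _ _ (A `*` B `*` [set: nat])).
    by apply: subset_card_le; exact: subIsetl.
  by do 2?apply: countableX.
exists U, V; first by move=> i; split; exact: open_interior.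
apply/seteqP; split=> [[x y] Oxy|p [i [_ +] UVp]]; last by apply.
have /nbhs_ballP[e /= e0 xyO] : nbhs (x, y) O by exact: open_nbhs_nbhs.
have [n ne] : exists n : nat, n.+1%:R^-1 < e / 2.
  by have /ltr_add_invr[n] := divr_gt0 e0 (ltr0n _ 2); rewrite add0r; exists n.
pose r : R := n.+1%:R^-1.
have r0 : 0 < r / 2 by rewrite divr_gt0// invr_gt0.
have halfr : r / 2 <= r by rewrite ler_pdivrMr// ler_peMr ?ler1n// invr_ge0.
have center (W : pseudoMetricType R) (D : set W) (w : W) : dense D ->
    exists a, [/\ D a, (ball a r)° w & ball a r `<=` ball w e].
  move=> /(_ (ball w (r / 2))°)[||a [/= /interior_subset wa Da]].
  - by exists w; exact: nbhsx_ballx.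
  - exact: open_interior.
  exists a; split => //.
    apply/nbhs_ballP; exists (r / 2) => //= z wz.
    by apply: (ball_split _ wz); exact: ball_sym.
  move=> z az; apply: (@le_ball _ _ _ (r + r)).
    by rewrite [e]splitr lerD// ltW.
  by apply: (ball_triangle _ az); exact: le_ball wa.
have [a [Aa xa aO]] := center _ _ x dA.
have [b [Bb yb bO]] := center _ _ y dB.
exists (a, b, n) => //; split => // -[s t] [/= Us Vt].
by apply: xyO; split => /=; [apply: aO|apply: bO]; exact: interior_subset.
Qed.

Variable E : separableBanachType R.

Lemma measurable_borel d (T : measurableType d) (f : T -> borel E) :
  (forall O : set E, open O -> measurable (f @^-1` O)) ->
  measurable_fun setT f.
Proof.
move=> fO; apply: (@measurability _ _ T (borel E) setT f (@open E)) => //.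
by move=> _ [U oU <-]; rewrite setTI; exact: fO.
Qed.

Lemma measurable_borel_add :
  measurable_fun setT (fun p : borel E * borel E => (p.1 : E) + p.2 : borel E).
Proof.
apply: measurable_borel => O oO.
have [|D cD [U [V oUV]]] := @open_prodE E E ((fun p => p.1 + p.2) @^-1` O)
  separable_subproof separable_subproof.
  by apply: open_comp oO => p _; exact: add_continuous.
move=> /= ->; apply: countable_bigcup_measurable => // i _.
by have [oU oV] := oUV i; apply: measurableX; exact: sub_gen_smallest.
Qed.

Lemma measurable_borel_scale :
  measurable_fun setT (fun p : R * borel E => p.1 *: (p.2 : E) : borel E).
Proof.
apply: measurable_borel => O oO.
have [|D cD [U [V oUV]]] := @open_prodE R E ((fun p => p.1 *: p.2) @^-1` O)
  separable_real separable_subproof.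
  by apply: open_comp oO => p _; exact: scale_continuous.
move=> /= ->; apply: countable_bigcup_measurable => // i _.
have [oU oV] := oUV i; apply: measurableX; last exact: sub_gen_smallest.
exact: open_measurable.
Qed.

End joint_measurability.

Section laws_on_reals.
Context {R : realType}.
Implicit Type lam : probability R R.

Definition mul_real (a : R) : R -> R := *%R a.
Lemma measurable_mul_real a : measurable_fun setT (mul_real a).
Proof. exact: mulrl_measurable. Qed.
HB.instance Definition _ a :=
  isMeasurableFun.Build _ _ _ _ (mul_real a) (measurable_mul_real a).

Definition rscale_law (a : R) lam : probability R R :=
  distribution lam (mul_real a).

Definition abs_real : R -> R := Num.norm.
Lemma measurable_abs_real : measurable_fun setT abs_real.
Proof. exact: normr_measurable. Qed.
HB.instance Definition _ :=
  isMeasurableFun.Build _ _ _ _ abs_real measurable_abs_real.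

Definition abs_law lam : probability R R := distribution lam abs_real.

End laws_on_reals.

Section laws_on_banach.
Context {R : realType} {E : separableBanachType R}.
Implicit Types (mu nu : probability (borel E) R) (lam : probability R R).

Definition dirac_zero : probability (borel E) R := @dirac _ (borel E) (0 : E) R.

Definition mul_banach (a : R) (x : borel E) : borel E := a *: (x : E).
Lemma measurable_mul_banach a : measurable_fun setT (mul_banach a).
Proof.
have := @pair1_measurable _ _ R (borel E) a.
exact: (@measurableT_comp _ _ _ _ _ _ _ _ _ (@measurable_borel_scale R E)).
Qed.
HB.instance Definition _ a :=
  isMeasurableFun.Build _ _ _ _ (mul_banach a) (measurable_mul_banach a).

Definition scale_law (a : R) nu : probability (borel E) R :=
  distribution nu (mul_banach a).

Definition add_banach (p : borel E * borel E) : borel E := (p.1 : E) + p.2.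
HB.instance Definition _ :=
  isMeasurableFun.Build _ _ _ _ add_banach (@measurable_borel_add R E).

Definition convolution mu nu : probability (borel E) R :=
  distribution (mu \x nu)%E add_banach.

Definition smul_banach (p : R * borel E) : borel E := p.1 *: (p.2 : E).
HB.instance Definition _ :=
  isMeasurableFun.Build _ _ _ _ smul_banach (@measurable_borel_scale R E).

Section scale_mixture.
Variables (mu : probability (borel E) R) (lam : probability R R).

Definition scale_mixture_fun (A : set (borel E)) : \bar R :=
  (\int[lam]_s scale_law s mu A)%E.

Lemma scale_mixture_funE :
  scale_mixture_fun = distribution (lam \x mu)%E smul_banach.
Proof.
apply/funext => A; apply: eq_integral => s _ /=.
by rewrite /scale_law /distribution /pushforward /= /xsection/=;
  congr (mu _); apply/seteqP; split=> x /=; rewrite inE.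
Qed.

Lemma scale_mixture0 : scale_mixture_fun set0 = 0%E.
Proof. by rewrite scale_mixture_funE measure0. Qed.

Lemma scale_mixture_ge0 A : (0 <= scale_mixture_fun A)%E.
Proof. by rewrite scale_mixture_funE measure_ge0. Qed.

Lemma scale_mixture_sigma_additive : semi_sigma_additive scale_mixture_fun.
Proof. by rewrite scale_mixture_funE; exact: measure_semi_sigma_additive. Qed.

HB.instance Definition _ := isMeasure.Build _ _ _ scale_mixture_fun
  scale_mixture0 scale_mixture_ge0 scale_mixture_sigma_additive.

Lemma scale_mixture_setT : scale_mixture_fun setT = 1%E.
Proof. by rewrite scale_mixture_funE probability_setT. Qed.

HB.instance Definition _ := Measure_isProbability.Build _ _ _
  scale_mixture_fun scale_mixture_setT.

Definition scale_mixture : probability (borel E) R := scale_mixture_fun.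

End scale_mixture.

(* Laws are compared with the library's [≡μ], i.e. on measurable sets only:
   Leibniz equality of measures would also compare the junk values of the
   underlying set functions on nonmeasurable sets. *)
Definition weakly_stable mu :=
  forall lam1 lam2, exists lam,
    convolution (scale_mixture mu lam1) (scale_mixture mu lam2)
      ≡μ scale_mixture mu lam.

Definition symmetric_law mu := scale_law (-1) mu ≡μ mu.

(* For symmetric [mu], [lam] is only determined by [scale_mixture mu lam] up to
   the signs of its values, and |lam| is the chosen representative. *)
Definition canonical_law mu lam : probability R R :=
  if `[< symmetric_law mu >] then abs_law lam else lam.

(* The graph [rho = lam1 (+)_mu lam2] of the generalized convolution. For [mu]
   weakly stable and different from the Dirac mass at 0, the first equation
   determines [canonical_law mu lam], so that the graph is that of a total
   function. *)
Definition is_gconv mu lam1 lam2 rho :=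
  exists2 lam,
    convolution (scale_mixture mu lam1) (scale_mixture mu lam2)
      ≡μ scale_mixture mu lam &
    rho ≡μ canonical_law mu lam.

(* The right-hand side is normalized like the left-hand side: when [mu] is
   symmetric the condition is that T_a lam (+) T_b lam = |T_c lam|. *)
Definition weakly_stable_wrt mu lam :=
  forall a b : R, 0 < a -> 0 < b -> exists2 c : R, 0 < c &
    is_gconv mu (rscale_law a lam) (rscale_law b lam)
      (canonical_law mu (rscale_law c lam)).

Definition strictly_stable nu :=
  forall a b : R, 0 < a -> 0 < b -> exists2 c : R, 0 < c &
    convolution (scale_law a nu) (scale_law b nu) ≡μ scale_law c nu.

Definition strictly_alpha_stable (alpha : R) nu :=
  forall a b : R, 0 < a -> 0 < b ->
    convolution (scale_law a nu) (scale_law b nu) ≡μ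
    scale_law ((a `^ alpha + b `^ alpha) `^ alpha^-1) nu.

End laws_on_banach.

(* Main.v *)
Require Import Defs.
From mathcomp Require Import all_boot all_order all_algebra.
From mathcomp Require Import all_classical all_reals all_analysis.
From mathcomp Require Import measurable_realfun giry.
From mathcomp Require Import ring lra.
Set Implicit Arguments.
Unset Strict Implicit.
Unset Printing Implicit Defensive.
Import Order.TTheory GRing.Theory Num.Theory.
Import numFieldNormedType.Exports.
Local Open Scope classical_set_scope.
Local Open Scope ring_scope.

(** The equivalence is formal. The mixture of $T_a \lambda$ with $\mu$ is
    $T_a(\lambda \circ \mu)$, and replacing $\lambda$ by $|\lambda|$ does not
    change the mixture when $\mu$ is symmetric; hence both sides state that
    $T_a \nu * T_b \nu = T_c \nu$ for $\nu = \lambda \circ \mu$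
    ([weakly_stable_wrtP]).

    The existence of the index is a fact about an arbitrary strictly stable
    Borel law $\nu$ on a separable Banach space ([strictly_stable_index]). For a
    continuous linear functional $f$ let $\varphi(t) = |E e^{itf(X)}|^2$, where
    $X \sim \nu$. It is continuous, and $T_a \nu * T_b \nu = T_c \nu$ gives
    $\varphi(ct) = \varphi(at) \varphi(bt)$ ([strictly_stable_char]).

    Suppose that $\varphi \not\equiv 1$ for some $f$. Then $\varphi > 0$
    ([stable_modulus_gt0]), and $\psi = - \ln \varphi$ satisfies
    $\psi(ct) = \psi(at) + \psi(bt)$. The pairs $(c, q)$ with
    $\psi(ct) = q \psi(t)$ for all $t$ form a group in which $c < 1$ forces
    $q < 1$, since $\psi(c^n t) \to 0$. This group contains a pair $(c, n)$ for
    every integer $n \ge 1$, and comparing powers forces $c = n^\beta$ for a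
    fixed $\beta > 0$; the law extends to rational $q$, and to all $q > 0$ by
    continuity. With $\alpha = 1/\beta$ this is $\psi(at) = a^\alpha \psi(t)$
    ([stable_exponent_exists]), so that $c^\alpha = a^\alpha + b^\alpha$ is
    forced in the original relation. The bound $\alpha \le 2$ comes from
    $|\chi(2t)| \ge 2 |\chi(t)|^2 - 1$, valid for every characteristic function
    $\chi$ ([char_sqnorm_double]), as $t \to 0$ ([exponent_le2]).

    If $\varphi \equiv 1$ for all functionals of a countable separating family,
    then $\nu$ is the Dirac mass at a point ([degenerate_dirac]), and $\alpha = 1$.
    Separability and the Hahn-Banach theorem provide such a family
    ([separating_sequence]). *)

(** * Functions scaled by dilations: the exponent of stability *)

Section real_facts.
Context {R : realType}.
Implicit Types b c t x y : R.

Lemma le_of_nat_multiples x y : 0 <= x ->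
  (forall n m : nat, n%:R * x < m%:R -> n%:R * y <= m%:R) -> y <= x.
Proof.
move=> x0 xy; rewrite leNgt; apply/negP => ltxy.
pose n := (Num.trunc (y - x)^-1).+1.
have yx0 : 0 < y - x by rewrite subr_gt0.
have nyx : 1 < n%:R * (y - x).
  by rewrite -[ltLHS](mulVf (lt0r_neq0 yx0)) ltr_pM2r// truncnS_gt.
have /andP[mx xm] := truncn_itv (mulr_ge0 (ler0n R n) x0).
have := xy _ _ xm; rewrite -natr1; lra.
Qed.

Lemma continuous_scaled_pow (f : R -> R) c t : continuous f -> `|c| < 1 ->
  f (c ^+ n * t) @[n --> \oo] --> f 0.
Proof.
move=> fc c1; apply: (cvg_comp (fun n => c ^+ n * t)); last exact: fc.
have h := cvgM (cvg_expr c1) (@cvg_cst _ t _ eventually _).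
by rewrite mul0r in h; exact: h.
Qed.

Lemma continuous_powRl b x : 0 < x -> {for x, continuous (fun y => y `^ b)}.
Proof.
move=> x0; apply: differentiable_continuous; apply/derivable1_diffP.
by apply: derivable_powR; rewrite in_itv/= x0.
Qed.

End real_facts.

Section dilations.
Context {R : realType}.
Variables (psi : R -> R) (t0 : R).
Hypothesis psi_cont : continuous psi.
Hypothesis psi0 : psi 0 = 0.
Hypothesis psi_t0 : 0 < psi t0.

(** The pairs with positive entries form a multiplicative group; when [psi] is
    minus the logarithm of a stable modulus, it is the graph of a power
    function. *)
Definition dilates (c q : R) := forall t, psi (c * t) = q * psi t.

Lemma dilatesM c q d r : dilates c q -> dilates d r -> dilates (c * d) (q * r).
Proof. by move=> cq dr t; rewrite -!mulrA cq dr. Qed.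

Lemma dilatesX c q n : dilates c q -> dilates (c ^+ n) (q ^+ n).
Proof.
move=> cq; elim: n => [|n IH]; first by move=> t; rewrite !expr0 !mul1r.
by rewrite !exprS; exact: dilatesM.
Qed.

Lemma dilatesV c q : c != 0 -> q != 0 -> dilates c q -> dilates c^-1 q^-1.
Proof. by move=> c0 q0 cq t; rewrite -{2}(mulVKf c0 t) cq mulKf. Qed.

(** A contraction iterated on [t0] tends to 0, where [psi] vanishes, and
    $\psi(c^n t_0) = q^n \psi(t_0)$. *)
Lemma dilates_lt1 c q : 0 <= c < 1 -> dilates c q -> q < 1.
Proof.
move=> /andP[c0 c1] cq; rewrite ltNge; apply/negP => q1.
have : psi (c ^+ n * t0) @[n --> \oo] --> psi 0.
  by apply: continuous_scaled_pow => //; rewrite ger0_norm.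
rewrite psi0 => /cvgr_lt /(_ _ psi_t0)[N _ /(_ N (leqnn N))] /=.
rewrite (dilatesX N cq) ltNge => /negP; apply.
by rewrite ler_peMl// ?exprn_ege1// ltW.
Qed.

Lemma dilates_gt1 c q : 1 < c -> 0 < q -> dilates c q -> 1 < q.
Proof.
move=> c1 q0 cq; have c0 : 0 < c by exact: lt_trans c1.
rewrite -invf_lt1//; apply: (@dilates_lt1 c^-1).
  by rewrite invr_ge0 ltW//= invf_lt1.
by apply: dilatesV => //; rewrite gt_eqF.
Qed.

(** The group relation reduces this to [dilates_lt1] for $(c/d, q/r)$ or its
    inverse: the monotonicity of the correspondence between factors comes from
    the continuity of [psi] at 0. *)
Lemma dilates_lt c q d r : 0 < c -> 0 < d -> 0 < q -> 0 < r ->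
  dilates c q -> dilates d r -> (c < d) = (q < r).
Proof.
move=> c0 d0 q0 r0 cq dr.
have ratio : dilates (c / d) (q / r).
  by apply: dilatesM => //; apply: dilatesV; rewrite ?gt_eqF.
have [cd|dc|cd] := ltgtP c d.
- have /dilates_lt1/(_ ratio) : 0 <= c / d < 1.
    by rewrite divr_ge0 1?ltW//= ?ltr_pdivrMr ?mul1r// ltW.
  by rewrite ltr_pdivrMr// mul1r.
- have /dilates_gt1/(_ _ ratio) : 1 < c / d by rewrite ltr_pdivlMr// mul1r.
  by rewrite divr_gt0// ltr_pdivlMr// mul1r => /(_ isT)/ltW; rewrite ltNge => ->.
- move: ratio; rewrite cd divff ?gt_eqF// => /(_ t0); rewrite mul1r.
  rewrite -{1}(mul1r (psi t0)) => /(mulIf (lt0r_neq0 psi_t0)) /esym/divr1_eq ->.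
  by rewrite ltxx.
Qed.

Lemma dilates1 : dilates 1 1.
Proof. by move=> t; rewrite !mul1r. Qed.

(** Both sides are determined by the comparisons of $c^n$ with $d^m$, that is,
    of $q^n$ with $r^m$, for all exponents. *)
Lemma dilates_ln c q d r : 1 <= c -> 1 < d -> 1 <= q -> 1 < r ->
  dilates c q -> dilates d r -> ln c / ln d = ln q / ln r.
Proof.
move=> c1 d1 q1 r1 cq dr.
have pos x : 1 <= x -> 0 < x by exact: lt_le_trans.
have [[c0 d0] [q0 r0]] : (0 < c /\ 0 < d) /\ (0 < q /\ 0 < r).
  by split; split; apply: pos => //; exact: ltW.
have lnge0 x y : 1 <= x -> 1 < y -> 0 <= ln x / ln y.
  by move=> x1 y1; rewrite divr_ge0 ?ln_ge0// ltW.
have lnlt n m x y : 1 <= x -> 1 < y ->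
    (n%:R * (ln x / ln y) < m%:R) = (x ^+ n < y ^+ m).
  move=> x1 y1; have [x0 y0] : 0 < x /\ 0 < y by split; apply: pos => //; exact: ltW.
  by rewrite mulrA ltr_pdivrMr ?ln_gt0// !mulr_natl -!lnXn// ltr_ln ?posrE ?exprn_gt0.
have key n m : (n%:R * (ln c / ln d) < m%:R) = (n%:R * (ln q / ln r) < m%:R).
  by rewrite !lnlt//; apply: dilates_lt; rewrite ?exprn_gt0//; exact: dilatesX.
apply/eqP; rewrite eq_le; apply/andP; split; apply: le_of_nat_multiples;
  rewrite ?lnge0// => n m; [rewrite -key|rewrite key]; exact: ltW.
Qed.

End dilations.

Section stable_exponent.
Context {R : realType}.
Variables (psi : R -> R) (t0 : R).
Hypothesis psi_cont : continuous psi.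
Hypothesis psi0 : psi 0 = 0.
Hypothesis psi_t0 : 0 < psi t0.
Hypothesis psi_stable : forall a b, 0 < a -> 0 < b ->
  exists2 c, 0 < c & forall t, psi (c * t) = psi (a * t) + psi (b * t).

Lemma dilates_nat n : (0 < n)%N -> exists2 c, 0 < c & dilates psi c n%:R.
Proof.
case: n => // + _; elim=> [|n [c c0 cn]]; first by exists 1 => //; exact: dilates1.
have [d d0 dE] := psi_stable c0 ltr01.
by exists d => // t; rewrite dE cn mul1r -[in RHS]natr1 mulrDl mul1r.
Qed.

(** The dilation factor of 2 fixes the exponent, and [dilates_ln] transports
    it to all other integers. *)
Lemma dilates_nat_powR : exists2 b, 0 < b &
  forall n, (0 < n)%N -> dilates psi (n%:R `^ b) n%:R.
Proof.
have [c2 c20 d2] := @dilates_nat 2 isT.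
have dlt := dilates_lt psi_cont psi0 psi_t0.
have c21 : 1 < c2.
  by rewrite (dlt _ _ _ _ ltr01 c20 ltr01 _ (dilates1 psi) d2) ?ltr0n// ltr1n.
have ln2 : 0 < ln 2 :> R by rewrite ln_gt0// ltr1n.
exists (ln c2 / ln 2); first by rewrite divr_gt0// ln_gt0.
move=> n n0; have [c c0 dc] := dilates_nat n0.
have n1 : 1 <= n%:R :> R by rewrite ler1n.
have nR0 : 0 < n%:R :> R by rewrite ltr0n.
have c1 : 1 <= c.
  by rewrite leNgt (dlt _ _ _ _ c0 ltr01 nR0 ltr01 dc (dilates1 psi)) -leNgt.
have := dilates_ln psi_cont psi0 psi_t0 c1 c21 n1 _ dc d2.
rewrite ltr1n => /(_ isT) lnE.
suff -> : n%:R `^ (ln c2 / ln 2) = c by [].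
apply: ln_inj; rewrite ?posrE ?powR_gt0// ln_powR.
by rewrite -mulrA [_^-1 * _]mulrC -lnE mulrC divfK// gt_eqF// ln_gt0.
Qed.

Lemma dilates_rat b : (forall n, (0 < n)%N -> dilates psi (n%:R `^ b) n%:R) ->
  forall r : rat, 0 < r -> dilates psi (ratr r `^ b) (ratr r).
Proof.
move=> dn r r0.
have -> : ratr r = `|numq r|%N%:R / `|denq r|%N%:R :> R.
  rewrite /ratr -{1}(gtz0_abs (denq_gt0 r)).
  by rewrite -{1}(gtz0_abs (_ : 0 < numq r)) ?numq_gt0.
have [nr dr] : (0 < `|numq r|)%N /\ (0 < `|denq r|)%N.
  by rewrite !absz_gt0 denq_neq0 numq_eq0 gt_eqF.
rewrite powRM ?invr_ge0// -[X in _ * X `^ b]powR_inv1// powRAC powR_inv1 ?powR_ge0//.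
apply: dilatesM; first exact: dn.
by apply: dilatesV; [| |exact: dn]; rewrite gt_eqF ?powR_gt0 ?ltr0n.
Qed.

(** The scaling law extends from rational to real factors by continuity. *)
Lemma dilates_powR b : (forall n, (0 < n)%N -> dilates psi (n%:R `^ b) n%:R) ->
  forall x, 0 < x -> dilates psi (x `^ b) x.
Proof.
move=> dn x x0 t; apply/eqP; rewrite -subr_eq0; apply: contraPT isT => D0.
pose D y := psi (y `^ b * t) - y * psi t.
have Dx : D y @[y --> x] --> D x.
  apply: cvgB; last by apply: cvgM; [exact: cvg_id|exact: cvg_cst].
  apply: (cvg_comp (fun y => y `^ b * t)); last exact: psi_cont.
  by apply: cvgM; [exact: continuous_powRl|exact: cvg_cst].
have : \forall y \near x, 0 < y /\ D y != 0.
  by near=> y; split; near: y; [exact: lt_nbhsr|exact: cvgr_neq0 Dx D0].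
move=> /nbhs_ballP[e /= e0 eD].
have [|r] := @rat_in_itvoo _ (x - e) (x + e); first by lra.
rewrite in_itv/= => /andP[er re].
have [|r0] := eD (ratr r); first by rewrite /ball/= ltr_norml; lra.
by rewrite /D (dilates_rat dn) ?subrr ?eqxx// -(ltr0q R).
Unshelve. all: by end_near. Qed.

Lemma stable_exponent_exists : exists2 alpha, 0 < alpha &
  forall a, 0 < a -> dilates psi a (a `^ alpha).
Proof.
have [b b0 /dilates_powR db] := dilates_nat_powR.
exists b^-1; first by rewrite invr_gt0.
move=> a a0; rewrite -{1}(powRr1 (ltW a0)) -(mulVf (lt0r_neq0 b0)) powRrM.
exact/db/powR_gt0.
Qed.

End stable_exponent.

(** Near 0, with $s = \psi(t)$, the assumed inequality reads
    $1 - 2 s \le 1 - 2^{\alpha - 1} s$ up to terms of second order in $s$. *)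
Lemma exponent_le2 {R : realType} (psi : R -> R) (t0 alpha : R) :
  continuous psi -> psi 0 = 0 -> 0 < psi t0 ->
  (forall a, 0 < a -> dilates psi a (a `^ alpha)) ->
  (forall t, 2 * expR (- psi t) - 1 <= expR (- psi (2 * t) / 2)) ->
  alpha <= 2.
Proof.
move=> psi_cont psi0 psi_t0 da ineq; rewrite leNgt; apply/negP => a2.
pose A := 2 `^ alpha : R.
have A4 : 4 < A.
  have -> : 4 = 2 `^ 2 :> R by rewrite (powR_mulrn 2)// -natrX.
  by rewrite /A /powR !gt_eqF ?ltr0n// ltr_expR ltr_pM2r ?ln_gt0// ltr1n.
have small s : 0 < s -> (exists t, psi t = s) -> A / 2 <= 2 + A * s.
  move=> s0 [t ts].
  have := ineq t; rewrite da// -/A ts => h.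
  (* $e^{-u} \le (1 + u)^{-1}$ with $u = 2^\alpha s / 2$ avoids any expansion *)
  have e1 := expR_ge1Dx (- s).
  have e2 := expR_ge1Dx (A * s / 2).
  have : (2 * (1 - s) - 1) * (1 + A * s / 2) <= 1.
    have u1 : 0 < 1 + A * s / 2 by rewrite addr_gt0// !mulr_gt0 ?invr_gt0//; lra.
    rewrite -ler_pdivlMr// mul1r.
    apply: (@le_trans _ _ (expR (- (A * s) / 2))); first by lra.
    by rewrite mulNr expRN lef_pV2// posrE ?expR_gt0.
  move=> h2; have : s * (A / 2) <= s * (2 + A * s) by nra.
  by rewrite ler_pM2l.
have half n : psi (2^-1 ^+ n * t0) = (2^-1 `^ alpha) ^+ n * psi t0.
  by apply: dilatesX; apply: da; rewrite invr_gt0.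
have : A * psi (2^-1 ^+ n * t0) @[n --> \oo] --> A * psi 0.
  apply: cvgM; first exact: cvg_cst.
  by apply: continuous_scaled_pow => //; rewrite ger0_norm// invf_lt1 ?ltr1n.
rewrite psi0 mulr0 => /cvgr_lt/(_ (A / 2 - 2)).
have -> : 0 < A / 2 - 2 by lra.
move=> /(_ isT)[N _ /(_ N (leqnn N))] /= lt.
have := small (psi (2^-1 ^+ N * t0)); rewrite {1}half.
rewrite mulr_gt0 ?exprn_gt0 ?powR_gt0 ?invr_gt0// => /(_ isT (ex_intro _ _ erefl)).
lra.
Qed.

Section index_of_stability.
Context {R : realType}.
Variables (phi : R -> R) (t0 : R).
Hypothesis phi_cont : continuous phi.
Hypothesis phi0 : phi 0 = 1.
Hypothesis phi_ge0 : forall t, 0 <= phi t.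
Hypothesis phi_le1 : forall t, phi t <= 1.
Hypothesis phi_t0 : phi t0 < 1.
Hypothesis phi_stable : forall a b, 0 < a -> 0 < b ->
  exists2 c, 0 < c & forall t, phi (c * t) = phi (a * t) * phi (b * t).

(** From $\varphi(c t) = \varphi(t)^2$: a zero of $\varphi$ propagates towards
    0 when $c > 1$; when $c < 1$ the values $\varphi(c^n t_0)$ decrease, while
    they should tend to $\varphi(0) = 1$; and $c = 1$ makes $\varphi$ a
    continuous function with values in $\{0, 1\}$. *)
Lemma stable_modulus_gt0 t : 0 < phi t.
Proof.
have [c c0 cE] := phi_stable ltr01 ltr01.
have sq u : phi (c * u) = phi u ^+ 2 by rewrite cE mul1r.
have [c1|c1|c1] := ltgtP c 1.
- have dec n : phi (c ^+ n * t0) <= phi t0.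
    elim: n => [|n IH]; first by rewrite expr0 mul1r.
    by rewrite exprS -mulrA sq (le_trans _ IH)// expr2 ler_piMl.
  have : phi (c ^+ n * t0) @[n --> \oo] --> phi 0.
    by apply: continuous_scaled_pow => //; rewrite gtr0_norm.
  rewrite phi0 => /cvgr_gt/(_ _ phi_t0)[N _ /(_ N (leqnn N))] /=.
  by rewrite ltNge dec.
- rewrite lt_neqAle phi_ge0 andbT eq_sym; apply/eqP => phit.
  have zero n : phi (c^-1 ^+ n * t) = 0.
    elim: n => [|n IH]; first by rewrite expr0 mul1r.
    apply/eqP; rewrite -sqrf_eq0 -sq exprS -mulrA (mulVKf (lt0r_neq0 c0)).
    exact/eqP.
  have : phi (c^-1 ^+ n * t) @[n --> \oo] --> phi 0.
    by apply: continuous_scaled_pow => //; rewrite gtr0_norm ?invr_gt0// invf_lt1.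
  rewrite phi0 => /cvgr_gt/(_ _ ltr01)[N _ /(_ N (leqnn N))] /=.
  by rewrite zero ltxx.
- have idem u : phi u = phi u ^+ 2 by rewrite -sq c1 mul1r.
  have phit0 : phi t0 = 0.
    have /eqP := idem t0; rewrite expr2 -subr_eq0 -{1}[phi t0]mulr1 -mulrBr.
    by rewrite mulf_eq0 subr_eq0 => /orP[/eqP//|/eqP h]; move: phi_t0; rewrite -h ltxx.
  have [|||s _] := @IVT _ (fun s => phi (s * t0)) 0 1 2^-1.
  + exact: ler01.
  + apply: continuous_subspaceT => s.
    apply: (cvg_comp (fun s => s * t0)); last exact: phi_cont.
    by apply: cvgM; [exact: cvg_id|exact: cvg_cst].
  + rewrite mul0r mul1r phi0 phit0 min_r ?max_l ?ler01//.
    by rewrite invr_ge0 ler0n invf_le1 ?ler1n.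
  by move=> h; have := idem (s * t0); rewrite h; lra.
Qed.

(** $\psi = - \ln \varphi$ turns the stability relation into an additive one
    and the doubling inequality into the one of [exponent_le2]. *)
Lemma stable_modulus_index :
  (forall t, 2 * phi t - 1 <= Num.sqrt (phi (2 * t))) ->
  exists alpha, 0 < alpha <= 2 /\ forall a b c, 0 < a -> 0 < b -> 0 < c ->
    (forall t, phi (c * t) = phi (a * t) * phi (b * t)) ->
    c = (a `^ alpha + b `^ alpha) `^ alpha^-1.
Proof.
move=> bern; have phi_gt0 := stable_modulus_gt0.
pose psi t := - ln (phi t).
have psi_cont : continuous psi.
  move=> t; apply: cvgN; apply: (cvg_comp phi); first exact: phi_cont.
  exact: continuous_ln.
have psi0 : psi 0 = 0 by rewrite /psi phi0 ln1 oppr0.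
have psi_t0 : 0 < psi t0 by rewrite oppr_gt0 ln_lt0// phi_gt0.
have psiD a b c : (forall t, phi (c * t) = phi (a * t) * phi (b * t)) ->
    forall t, psi (c * t) = psi (a * t) + psi (b * t).
  by move=> phiD t; rewrite /psi phiD lnM ?posrE// opprD.
have [a b a0 b0|alpha alpha0 da] := stable_exponent_exists psi_cont psi0 psi_t0.
  by have [c c0 /psiD] := phi_stable a0 b0; exists c.
exists alpha; split.
  rewrite alpha0 (exponent_le2 psi_cont psi0 psi_t0 da)// => t.
  have expR_psi u : expR (- psi u) = phi u by rewrite opprK lnK ?posrE.
  rewrite expR_psi (le_trans (bern t))// expRM expR_psi.
  by rewrite powR12_sqrt.
move=> a b c a0 b0 c0 /psiD/(_ t0); rewrite !da// -mulrDl.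
move=> /(mulIf (lt0r_neq0 psi_t0)) <-.
by rewrite -powRrM divff ?gt_eqF// powRr1// ltW.
Qed.

End index_of_stability.

(** * Dominated extension of linear forms *)

Section hahn_banach.
Context {R : realType} {E : lmodType R}.
Variables (p : E -> R) (x0 : E).
Hypothesis p_hom : forall a x, 0 <= a -> p (a *: x) = a * p x.
Hypothesis p_subadd : forall x y, p (x + y) <= p x + p y.

(** The graph of a linear form defined on a subspace and dominated by [p]:
    domination makes such a relation single-valued, because
    $(0, r)$ and $(0, -r)$ in it give $r \le p(0) = 0$ and $-r \le 0$. The last
    clause lets the empty relation in, so that the empty chain has a union. *)
Definition dominated_graph (G : set (E * R)) :=
  [/\ forall a u v, G u -> G v -> G (a *: u.1 + v.1, a * u.2 + v.2),
      forall u, G u -> u.2 <= p u.1 &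
      forall u, G u -> G (x0, p x0)].

Lemma sublinear0 : p 0 = 0.
Proof. by rewrite -(scale0r 0) p_hom// mul0r. Qed.

Lemma dominated_graph_inj G x r s :
  dominated_graph G -> G (x, r) -> G (x, s) -> r = s.
Proof.
move=> [Glin Gle _].
wlog: r s / r < s => [th Gr Gs|rs Gr Gs].
  by have [/th->//|/th->//|//] := ltgtP r s.
have /Gle/= := Glin (-1) _ _ Gr Gs.
by rewrite scaleN1r addNr sublinear0; lra.
Qed.

Lemma dominated_graph_bigcup (F : set (set (E * R))) :
  F `<=` dominated_graph -> total_on F subset ->
  dominated_graph (\bigcup_(G in F) G).
Proof.
move=> FG Ftot; split.
- move=> a u v [G FGG Gu] [H FH Hv].
  have [GH|HG] := Ftot _ _ FGG FH.
    by exists H => //; have [Hlin _ _] := FG _ FH; apply: Hlin => //; exact: GH.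
  by exists G => //; have [Glin _ _] := FG _ FGG; apply: Glin => //; exact: HG.
- by move=> u [G /FG[_ + _]]; exact.
- by move=> u [G FGG Gu]; exists G => //; have [_ _] := FG _ FGG; apply; exact: Gu.
Qed.

Lemma dominated_graph_line :
  dominated_graph (range (fun a : R => (a *: x0, a * p x0))).
Proof.
split.
- move=> a _ _ [b _ <-] [c _ <-] /=; exists (a * b + c) => //.
  by rewrite scalerDl mulrDl scalerA mulrA.
- move=> _ [a _ <-] /=; have [a0|a0] := leP 0 a; first by rewrite p_hom.
  have := p_subadd (a *: x0) ((- a) *: x0).
  by rewrite -scalerDl subrr scale0r sublinear0 (@p_hom (- a)) ?oppr_ge0 ?(ltW a0)//; lra.
- by move=> _ _; exists 1 => //; rewrite scale1r mul1r.
Qed.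

(** One-dimensional extension: the new value [s] at [y] has to lie between
    $r - p(x - y)$ and $p(x + y) - r$ for all $(x, r)$ in the graph, which is
    possible since $r + r' \le p(x + x') \le p(x - y) + p(x' + y)$. *)
Lemma dominated_graph_extend G y : dominated_graph G -> G !=set0 ->
  exists s,
    dominated_graph [set (u.1 + a *: y, u.2 + a * s) | u in G & a in setT].
Proof.
move=> [Glin Gle Gx0] [w Gw].
have G0 : G (0, 0) by have := Glin (-1) _ _ Gw Gw; rewrite scaleN1r mulN1r !addNr.
have GZ a u : G u -> G (a *: u.1, a * u.2).
  by move=> /(Glin a _ _)/(_ G0); rewrite !addr0.
pose L := [set u.2 - p (u.1 - y) | u in G].
have LP u v : G u -> G v -> u.2 - p (u.1 - y) <= p (v.1 + y) - v.2.
  move=> Gu Gv; have := Gle _ (Glin 1 _ _ Gu Gv); rewrite scale1r mul1r /=.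
  have := p_subadd (u.1 - y) (v.1 + y).
  by rewrite addrACA addNr addr0; lra.
pose s := sup L.
have supL : has_sup L.
  split; first by exists (w.2 - p (w.1 - y)), w.
  by exists (p (w.1 + y) - w.2) => _ [u Gu <-]; exact: LP.
have ls u : G u -> u.2 - p (u.1 - y) <= s.
  by move=> Gu; apply: ub_le_sup; [exact: supL.2|exists u].
have su u : G u -> s <= p (u.1 + y) - u.2.
  by move=> Gu; apply: ge_sup; [exact: supL.1|move=> _ [v Gv <-]; exact: LP].
exists s; split.
- move=> a _ _ [u Gu [b _ <-]] [v Gv [c _ <-]] /=.
  exists (a *: u.1 + v.1, a * u.2 + v.2); first exact: Glin.
  exists (a * b + c) => //=; congr pair; last by ring.
  by rewrite scalerDr scalerDl scalerA addrACA.
- move=> _ [u Gu [a _ <-]] /=.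
  have [a0|a0|->] := ltgtP a 0; last by rewrite scale0r mul0r !addr0; exact: Gle.
  + have := ls _ (GZ (- a)^-1 _ Gu) => /= h.
    have na : 0 < - a by rewrite oppr_gt0.
    have -> : u.1 + a *: y = (- a) *: ((- a)^-1 *: u.1 - y).
      by rewrite scalerBr scalerA divff ?gt_eqF// scale1r scaleNr opprK.
    rewrite p_hom ?(ltW na)//; move: h; rewrite -(ler_pM2l na).
    by rewrite mulrBr mulVKf ?gt_eqF//; lra.
  + have := su _ (GZ a^-1 _ Gu) => /= h.
    have -> : u.1 + a *: y = a *: (a^-1 *: u.1 + y).
      by rewrite scalerDr scalerA divff ?gt_eqF// scale1r.
    rewrite p_hom ?(ltW a0)//; move: h; rewrite -(ler_pM2l a0).
    by rewrite mulrBr mulVKf ?gt_eqF//; lra.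
- by move=> _ _; exists (x0, p x0); [exact: Gx0 Gw|exists 0; rewrite // scale0r mul0r !addr0].
Qed.

(** A maximal dominated graph, given by Zorn's lemma, is total by
    [dominated_graph_extend]. *)
Theorem hahn_banach : exists f : E -> R,
  [/\ forall a x y, f (a *: x + y) = a * f x + f y,
      forall x, f x <= p x & f x0 = p x0].
Proof.
have [G [dG Gmax]] := Zorn_bigcup dominated_graph_bigcup.
have [Glin Gle Gx0] := dG.
have Gn0 : G !=set0.
  apply/set0P/negP => /eqP G0; apply: (Gmax _ _ dominated_graph_line).
  rewrite G0; split; first exact: sub0set.
  by move=> /(_ (x0, p x0)); apply; exists 1; rewrite // scale1r mul1r.
have total y : exists r, G (y, r).
  have [s dGs] := dominated_graph_extend y dG Gn0.
  apply: contrapT => nGy; apply: (Gmax _ _ dGs); split.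
    by move=> u Gu; exists u => //; exists 0 => //;
      rewrite scale0r mul0r !addr0 -surjective_pairing.
  move=> sub; apply: nGy; exists s; apply: sub.
  have [w Gw] := Gn0.
  exists (0, 0); first by have := Glin (-1) _ _ Gw Gw; rewrite scaleN1r mulN1r !addNr.
  by exists 1 => //; rewrite /= !add0r scale1r mul1r.
have [f Gf] := choice total; exists f; split.
- by move=> a x y; exact: dominated_graph_inj dG (Gf _) (Glin a _ _ (Gf x) (Gf y)).
- by move=> x; exact: (Gle _ (Gf x)).
- by have [w /Gx0 h] := Gn0; exact: dominated_graph_inj dG (Gf _) h.
Qed.

End hahn_banach.

(** * The modulus of a characteristic function *)

Section bounded_integrals.
Context d (T : measurableType d) (R : realType) (P : probability T R).
Implicit Types (f g : T -> R).

Lemma bounded_integrable f M : measurable_fun setT f ->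
  (forall x, `|f x| <= M) -> P.-integrable setT (EFin \o f).
Proof.
move=> mf fM; apply: measurable_bounded_integrable => //.
  by rewrite (le_lt_trans (probability_le1 _ _))// ltry.
by exists M; split; [exact: num_real|move=> y My x _ /=; rewrite (le_trans (fM x))// ltW].
Qed.

Lemma Rintegral_lin f g a b :
  P.-integrable setT (EFin \o f) -> P.-integrable setT (EFin \o g) ->
  P.-integrable setT (EFin \o (fun x => a * f x + b * g x)) /\
  \int[P]_x (a * f x + b * g x) = a * \int[P]_x f x + b * \int[P]_x g x.
Proof.
move=> fi gi.
have af : P.-integrable setT (EFin \o (fun x => a * f x)).
  exact: (integrableZl measurableT a fi).
have bg : P.-integrable setT (EFin \o (fun x => b * g x)).
  exact: (integrableZl measurableT b gi).
split; first exact: (integrableD measurableT af bg).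
by rewrite RintegralD// !RintegralZl.
Qed.

Lemma Rintegral_probability_cst a : \int[P]_(_ in setT) a = a.
Proof.
rewrite Rintegral_cst// -[RHS]mulr1; congr (_ * _).
exact: (congr1 fine (probability_setT P)).
Qed.

Lemma eq_measure_Rintegral (Q : probability T R) f : P ≡μ Q ->
  \int[P]_x f x = \int[Q]_x f x.
Proof. by move=> PQ; congr fine; apply: eq_measure_integral => A mA _; exact: PQ. Qed.

End bounded_integrals.

Lemma Rintegral_distribution d d' (T : measurableType d) (T' : measurableType d')
    (R : realType) (P : probability T R) (Y : {mfun T >-> T'}) (f : T' -> R) :
  measurable_fun setT f -> P.-integrable setT (EFin \o (f \o Y)) ->
  \int[distribution P Y]_y f y = \int[P]_x f (Y x).
Proof.
by move=> mf fi; congr fine; apply: integral_distribution => //; exact/measurable_EFinP.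
Qed.

Section product_integral.
Context d1 d2 (T1 : measurableType d1) (T2 : measurableType d2) (R : realType).
Variables (P : probability T1 R) (Q : probability T2 R).

Lemma Rintegral_prod_mul (f : T1 -> R) (g : T2 -> R) :
  measurable_fun setT f -> measurable_fun setT g ->
  (forall x, `|f x| <= 1) -> (forall y, `|g y| <= 1) ->
  (P \x Q)%E.-integrable setT (EFin \o (fun z => f z.1 * g z.2)) /\
  \int[(P \x Q)%E]_z (f z.1 * g z.2) = (\int[P]_x f x) * (\int[Q]_y g y).
Proof.
move=> mf mg f1 g1.
have fi := bounded_integrable P mf f1.
have gi := bounded_integrable Q mg g1.
have fgi : (P \x Q)%E.-integrable setT (EFin \o (fun z => f z.1 * g z.2)).
  apply: (@bounded_integrable _ _ _ _ _ 1).
    by apply: measurable_funM; apply: measurableT_comp.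
  by move=> z; rewrite normrM mulr_ile1.
split=> //; rewrite /Rintegral -(integral12_prod_meas1 fgi).
transitivity (fine (\int[P]_x (f x * \int[Q]_y g y)%:E)).
  congr fine; apply: eq_integral => x _; rewrite /fubini_F /=.
  rewrite -RintegralZl// /Rintegral fineK//.
  apply: integrable_fin_num => //; exact: (integrableZl measurableT (f x) gi).
by rewrite -/(Rintegral P setT (fun x => f x * \int[Q]_y g y)) RintegralZr.
Qed.

End product_integral.

Section characteristic_function.
Context d (T : measurableType d) (R : realType).
Implicit Types (P : probability T R) (X : T -> R) (t : R).

(** Real and imaginary part of the characteristic function $E e^{itX}$. *)
Definition char_re P X t : R := \int[P]_x cos (t * X x).
Definition char_im P X t : R := \int[P]_x sin (t * X x).
(** The characteristic function of $X - X'$, with $X'$ an independent copy of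
    $X$: passing to it symmetrizes the law. *)
Definition char_sqnorm P X t : R := char_re P X t ^+ 2 + char_im P X t ^+ 2.

Lemma norm_cos_le1 (x : R) : `|cos x| <= 1.
Proof. by rewrite ler_norml cos_geN1 cos_le1. Qed.

Lemma norm_sin_le1 (x : R) : `|sin x| <= 1.
Proof. by rewrite ler_norml sin_geN1 sin_le1. Qed.

Lemma measurable_cos_scaled X t : measurable_fun setT X ->
  measurable_fun setT (fun x => cos (t * X x)).
Proof.
move=> mX; apply: (@measurableT_comp _ _ _ _ _ _ cos).
  by apply: continuous_measurable_fun; exact: continuous_cos.
by apply: measurable_funM => //; exact: measurable_cst.
Qed.

Lemma measurable_sin_scaled X t : measurable_fun setT X ->
  measurable_fun setT (fun x => sin (t * X x)).
Proof.
move=> mX; apply: (@measurableT_comp _ _ _ _ _ _ sin).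
  by apply: continuous_measurable_fun; exact: continuous_sin.
by apply: measurable_funM => //; exact: measurable_cst.
Qed.

Section char_theory.
Variables (P : probability T R) (X : T -> R).
Hypothesis mX : measurable_fun setT X.
Let C := char_re P X.
Let S := char_im P X.
Let phi := char_sqnorm P X.

Let cosi t : P.-integrable setT (EFin \o (fun x => cos (t * X x))).
Proof.
by apply: (@bounded_integrable _ _ _ _ _ 1); [exact: measurable_cos_scaled|
  move=> x; exact: norm_cos_le1].
Qed.

Let sini t : P.-integrable setT (EFin \o (fun x => sin (t * X x))).
Proof.
by apply: (@bounded_integrable _ _ _ _ _ 1); [exact: measurable_sin_scaled|
  move=> x; exact: norm_sin_le1].
Qed.

Let csti a : P.-integrable setT (EFin \o (fun=> a)).
Proof. exact: (@bounded_integrable _ _ _ _ _ `|a|). Qed.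

Let continuous_char (f : R -> R) : continuous f -> (forall x, `|f x| <= 1) ->
  (forall t, P.-integrable setT (EFin \o (fun x => f (t * X x)))) ->
  continuous (fun t => \int[P]_x f (t * X x)).
Proof.
move=> fc f1 fi t.
have := @continuity_under_integral R _ T P (fun t x => f (t * X x)) setT
  measurableT (t - 1) (t + 1) (fun s _ => fi s) _ (cst 1) (csti 1) _ t.
apply.
- apply: aeW => x _ s _.
  apply: (cvg_comp (fun s => s * X x)); last exact: fc.
  by apply: cvgM; [exact: cvg_id|exact: cvg_cst].
- by move=> s _; apply: aeW => x _; exact: f1.
- by rewrite inE/= in_itv/=; lra.
Qed.

Lemma char_sqnorm_continuous : continuous phi.
Proof.
move=> t; apply: cvgD.
  apply: (cvg_comp C (fun z => z ^+ 2)); last exact: exprn_continuous.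
  by apply: (continuous_char (@continuous_cos R)) => //; exact: norm_cos_le1.
apply: (cvg_comp S (fun z => z ^+ 2)); last exact: exprn_continuous.
by apply: (continuous_char (@continuous_sin R)) => //; exact: norm_sin_le1.
Qed.

Lemma char_sqnorm0 : phi 0 = 1.
Proof.
rewrite /phi /char_sqnorm /char_re /char_im.
under eq_Rintegral do rewrite mul0r cos0.
under [in X in _ + X ^+ 2]eq_Rintegral do rewrite mul0r sin0.
by rewrite !Rintegral_probability_cst; ring.
Qed.

Lemma char_sqnorm_ge0 t : 0 <= phi t.
Proof. by rewrite addr_ge0// sqr_ge0. Qed.

(** The variance of the complex variable $e^{i t X}$. *)
Lemma char_variance t :
  \int[P]_x ((cos (t * X x) - C t) ^+ 2 + (sin (t * X x) - S t) ^+ 2) =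
  1 - phi t.
Proof.
have [i1 e1] := Rintegral_lin (- 2 * C t) (- 2 * S t) (cosi t) (sini t).
have [_ e2] := Rintegral_lin 1 1 i1 (csti (1 + phi t)).
transitivity (\int[P]_x (1 * (- 2 * C t * cos (t * X x) + - 2 * S t * sin (t * X x))
    + 1 * (1 + phi t))).
  apply: eq_Rintegral => x _.
  have := cos2Dsin2 (t * X x); rewrite /phi /char_sqnorm -/C -/S.
  set c := cos _; set s := sin _ => h.
  by lra.
rewrite e2 e1 Rintegral_probability_cst.
by rewrite /phi /char_sqnorm /C /S /char_re /char_im; ring.
Qed.

Lemma char_sqnorm_le1 t : phi t <= 1.
Proof.
rewrite -subr_ge0 -char_variance; apply: Rintegral_ge0 => x _.
by rewrite addr_ge0// sqr_ge0.
Qed.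

(** The variance of $e^{itX}$ vanishes, hence $e^{itX}$ is almost surely equal
    to its mean. *)
Lemma char_sqnorm_eq1 t : phi t = 1 ->
  {ae P, forall x, cos (t * X x) = C t /\ sin (t * X x) = S t}.
Proof.
move=> phi1; pose v x := (cos (t * X x) - C t) ^+ 2 + (sin (t * X x) - S t) ^+ 2.
have v0 x : 0 <= v x by rewrite addr_ge0// sqr_ge0.
have mv : measurable_fun setT v.
  by apply: measurable_funD; apply: measurable_funX; apply: measurable_funB => //;
    [exact: measurable_cos_scaled|exact: measurable_sin_scaled].
have vi : P.-integrable setT (EFin \o v).
  apply: (@bounded_integrable _ _ _ _ _ (1 + 2 * `|C t| + 2 * `|S t| + phi t)) => // x.
  rewrite ger0_norm// /v.
  have h := cos2Dsin2 (t * X x).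
  have hc : `|cos (t * X x) * C t| <= `|C t|.
    by rewrite normrM ler_piMl// norm_cos_le1.
  have hs : `|sin (t * X x) * S t| <= `|S t|.
    by rewrite normrM ler_piMl// norm_sin_le1.
  move: hc hs; rewrite !ler_norml /phi /char_sqnorm -/C -/S => /andP[? ?] /andP[? ?].
  by nra.
have : (\int[P]_x `|(v x)%:E| = 0)%E.
  under eq_integral do rewrite abse_EFin ger0_norm//.
  rewrite -[LHS]fineK; last by apply: integrable_fin_num.
  by congr EFin; rewrite -/(Rintegral P setT v) char_variance phi1 subrr.
move=> /(ae_eq_integral_abs _ measurableT).
have mev : measurable_fun setT (EFin \o v) by exact/measurable_EFinP.
move=> /(_ mev); apply: filterS => x /(_ Logic.I) [] /eqP.
rewrite paddr_eq0 ?sqr_ge0// !sqrf_eq0 !subr_eq0 => /andP[/eqP ? /eqP ?].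
by split.
Qed.

(** With $\theta$ an argument of $\chi(t) = E e^{itX}$,
    this is $|\chi(2t)| \ge E \cos(2(tX - \theta))
      \ge 2 (E \cos(tX - \theta))^2 - 1 = 2 |\chi(t)|^2 - 1$. *)
Lemma char_sqnorm_double t : 2 * phi t - 1 <= Num.sqrt (phi (2 * t)).
Proof.
set f := phi t; set g := phi (2 * t).
have [f0|f0] := eqVneq f 0; first by rewrite f0 mulr0 sub0r (le_trans _ (sqrtr_ge0 _)).
have {}f0 : 0 < f by rewrite lt_neqAle eq_sym f0 char_sqnorm_ge0.
have [i1 e1] := Rintegral_lin (4 * f * C t) (4 * f * S t) (cosi t) (sini t).
have [i2 e2] := Rintegral_lin (C t ^+ 2 - S t ^+ 2) (2 * C t * S t)
  (cosi (2 * t)) (sini (2 * t)).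
have [i3 e3] := Rintegral_lin 1 1 i1 (csti (- (2 * f ^+ 2 + f))).
(* With $u = \mathrm{Re}(\overline{\chi(t)} e^{itX})$, the two integrands
   are $4 f u - 2 f^2 - f$ and $2 u^2 - f$, so that the inequality is
   $(u - f)^2 \ge 0$; and $E u = f$. *)
have := le_Rintegral measurableT i3 i2.
rewrite e3 e2 e1 Rintegral_probability_cst.
rewrite -![\int[P]_x cos _]/(char_re P X _) -![\int[P]_x sin _]/(char_im P X _) -/C -/S.
move=> lower.
have {}lower : 2 * f ^+ 2 - f <=
    (C t ^+ 2 - S t ^+ 2) * C (2 * t) + 2 * C t * S t * S (2 * t).
  apply: le_trans (lower _); last move=> x _.
    by rewrite /f /phi /char_sqnorm -/C -/S; lra.
  have h := cos2Dsin2 (t * X x).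
  have -> : 2 * t * X x = (t * X x) *+ 2 by rewrite mulr2n; ring.
  rewrite cos_mulr2n sin_mulr2n.
  have fE : f = C t ^+ 2 + S t ^+ 2 by [].
  set c := cos _ in h *; set s := sin _ in h *.
  rewrite -subr_ge0; set D := (X in 0 <= X).
  have -> : D = 2 * (c * C t + s * S t - f) ^+ 2 - 2 * S t ^+ 2 * (c ^+ 2 + s ^+ 2 - 1).
    by rewrite /D fE; ring.
  by rewrite h subrr mulr0 subr0 mulr_ge0// sqr_ge0.
(* Cauchy-Schwarz for the plane vectors $\chi(t)^2$ and $\chi(2t)$ *)
have upper : (C t ^+ 2 - S t ^+ 2) * C (2 * t) + 2 * C t * S t * S (2 * t) <=
    f * Num.sqrt g.
  apply: le_trans (ler_norm _) _; rewrite -sqrtr_sqr -(ger0_norm (ltW f0)).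
  rewrite -sqrtr_sqr -sqrtrM ?sqr_ge0// ler_sqrt ?mulr_ge0 ?sqr_ge0 ?char_sqnorm_ge0//.
  rewrite /f /g /phi /char_sqnorm -/C -/S -subr_ge0.
  have := sqr_ge0 ((C t ^+ 2 - S t ^+ 2) * S (2 * t) - 2 * C t * S t * C (2 * t)).
  by congr (0 <= _); ring.
rewrite -(ler_pM2l f0); apply: le_trans (le_trans lower upper).
by rewrite le_eqVlt; apply/orP; left; apply/eqP; ring.
Qed.

End char_theory.
End characteristic_function.

(** * Countably many functionals separate the points of a separable space *)

Section separating_functionals.
Context {R : realType} {E : separableBanachType R}.

Definition dual_unit_ball (f : E -> R) :=
  (forall a x y, f (a *: x + y) = a * f x + f y) /\ forall x, f x <= `|x|.

Lemma norming_functional (x0 : E) : exists2 f, dual_unit_ball f & f x0 = `|x0|.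
Proof.
have normZ a (x : E) : 0 <= a -> `|a *: x| = a * `|x|.
  by move=> a0; rewrite normrZ ger0_norm.
have [f [flin fle fx0]] := hahn_banach x0 normZ (@ler_normD _ _).
by exists f.
Qed.

Section functional.
Variable f : E -> R.
Hypothesis fU : dual_unit_ball f.

Lemma functionalD x y : f (x + y) = f x + f y.
Proof. by have [/(_ 1 x y) + _] := fU; rewrite scale1r mul1r. Qed.

Lemma functional0 : f 0 = 0.
Proof. by have := functionalD 0 0; rewrite addr0; lra. Qed.

Lemma functionalZ a x : f (a *: x) = a * f x.
Proof. by have [/(_ a x 0) + _] := fU; rewrite functional0 !addr0. Qed.

Lemma functionalB x y : f (x - y) = f x - f y.
Proof. by rewrite -scaleN1r functionalD functionalZ mulN1r. Qed.

Lemma functional_norm x : `|f x| <= `|x|.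
Proof.
have [_ fle] := fU; rewrite ler_norml fle andbT lerNl.
by rewrite -(mulN1r (f x)) -functionalZ (le_trans (fle _))// scaleN1r normrN.
Qed.

Lemma functional_continuous : continuous f.
Proof.
move=> x; apply/cvgrPdist_lt => e e0; near=> y.
by rewrite -functionalB (le_lt_trans (functional_norm _)).
Unshelve. all: by end_near. Qed.

Lemma functional_measurable : measurable_fun setT (f : borel E -> R).
Proof.
apply: (measurability (@RGenOpens.G R)).
  exact: RGenOpens.measurableE.
move=> _ [_ [a [b ->] <-]]; rewrite setTI; apply: sub_sigma_algebra.
by apply: open_comp; [move=> x _; exact: functional_continuous|exact: interval_open].
Qed.

End functional.

(** Norming functionals for a countable dense set separate points: if [x] is in
    the common kernel and [d] is close to [x], then
    $\|d\| = f_d(d) = f_d(d - x) \le \|d - x\|$ is small. *)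
Lemma separating_sequence : exists f : nat -> E -> R,
  (forall n, dual_unit_ball (f n)) /\ forall x, (forall n, f n x = 0) -> x = 0.
Proof.
have [D cD dD] := separable_subproof : separable E.
move: cD => /pfcard_geP[D0|[g]].
  have [||x []] := dD setT; [by exists 0|exact: openT|by rewrite D0].
have /choice[F FE] : forall n, exists f, dual_unit_ball f /\ f (g n) = `|g n|.
  by move=> n; have [f] := norming_functional (g n); exists f.
exists F; split=> [n|x Fx]; first by have [] := FE n.
apply/eqP; rewrite -normr_eq0 eq_le normr_ge0 andbT leNgt; apply/negP => x0.
have [||d [/= xd Dd]] := dD (ball x (`|x| / 2)).
- by exists x; apply: ballxx; rewrite divr_gt0.
- exact: ball_open.
have [n _ gn] := @surj _ _ _ _ g d Dd.
have [FU Fg] := FE n.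
have := functional_norm FU (g n - x).
rewrite (functionalB FU) Fx subr0 Fg gn normr_id.
move: xd; rewrite -ball_normE /= => xd.
have := ler_normD (x - d) d; rewrite subrK (distrC d x).
by lra.
Qed.

End separating_functionals.

(** * Mixtures, convolutions and strict stability *)

Section equality_of_measures.
Context d (T : measurableType d) (R : realType).

Lemma measure_eq_sym (mu nu : probability T R) : mu ≡μ nu -> nu ≡μ mu.
Proof. by move=> h A mA; rewrite h. Qed.

Lemma measure_eq_trans (mu nu rho : probability T R) :
  mu ≡μ nu -> nu ≡μ rho -> mu ≡μ rho.
Proof. by move=> h k A mA; rewrite h// k. Qed.

Lemma measurable_preimage d' (T' : measurableType d') (Y : {mfun T >-> T'}) A :
  measurable A -> measurable (Y @^-1` A).
Proof. by move=> mA; rewrite -[X in measurable X]setTI; exact: measurable_funP. Qed.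

Lemma ae_eq_point_dirac (P : probability T R) (a : T) :
  {ae P, forall x, x = a} -> P ≡μ @dirac _ T a R.
Proof.
move=> [N [mN PN0 aN]] A mA; rewrite [RHS]diracE.
have null B : measurable B -> ~ B a -> P B = 0%E.
  move=> mB Ba; apply: (subset_measure0 mB mN) => // x Bx.
  by apply: aN => /= xa; apply: Ba; rewrite -xa.
have [/set_mem Aa|/negP aA] := boolP (a \in A).
  rewrite -(setCK A) [LHS]probability_setC; last exact: measurableC.
  by rewrite null ?sube0//; exact: measurableC.
by apply: null => // Aa; apply: aA; exact: mem_set.
Qed.

End equality_of_measures.

Section laws.
Context {R : realType} {E : separableBanachType R}.
Implicit Types (mu nu : probability (borel E) R) (lam : probability R R).

Lemma scale_law_eq a mu nu : mu ≡μ nu -> scale_law a mu ≡μ scale_law a nu.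
Proof. by move=> h A mA; apply: h; exact: measurable_preimage. Qed.

Lemma convolution_eq mu mu' nu nu' : mu ≡μ mu' -> nu ≡μ nu' ->
  convolution mu nu ≡μ convolution mu' nu'.
Proof.
move=> hmu hnu A mA.
transitivity (\int[mu']_x (nu \o xsection (@add_banach R E @^-1` A)) x)%E.
  by apply: eq_measure_integral => B mB _; exact: hmu.
apply: eq_integral => x _; apply: hnu; apply: measurable_xsection.
exact: measurable_preimage.
Qed.

Lemma measurable_scale_law mu A : measurable A ->
  measurable_fun setT (fun s : R => scale_law s mu A).
Proof.
move=> mA.
have -> : (fun s : R => scale_law s mu A) =
    mu \o xsection (@smul_banach R E @^-1` A).
  apply/funext => s /=; rewrite /scale_law /distribution /pushforward /xsection.
  by congr (mu _); apply/seteqP; split=> x /=; rewrite inE.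
by apply: measurable_fun_xsection; exact: measurable_preimage.
Qed.

Lemma scale_mixture_eq mu lam lam' : lam ≡μ lam' ->
  scale_mixture mu lam ≡μ scale_mixture mu lam'.
Proof. by move=> h A mA; apply: eq_measure_integral => B mB _; exact: h. Qed.

Lemma scale_law_comp a b mu A :
  scale_law (a * b) mu A = scale_law b mu (mul_banach a @^-1` A).
Proof.
rewrite /scale_law /distribution /pushforward; congr (mu _).
by apply/seteqP; split=> x /=; rewrite /mul_banach scalerA.
Qed.

Lemma scale_mixture_rscale a mu lam :
  scale_mixture mu (rscale_law a lam) ≡μ scale_law a (scale_mixture mu lam).
Proof.
move=> A mA.
transitivity (\int[lam]_s ((fun s => scale_law s mu A) \o mul_real a) s)%E.
  by apply: ge0_integral_distribution => //; exact: measurable_scale_law.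
by apply: eq_integral => s _; exact: scale_law_comp.
Qed.

(** For $s < 0$ write $|s| = s \cdot (-1)$ and absorb $-1$ into [mu]. *)
Lemma symmetric_scale_law_norm mu s A : symmetric_law mu -> measurable A ->
  scale_law `|s| mu A = scale_law s mu A.
Proof.
move=> sym mA; have [//|_] := ger0P s.
rewrite -[X in scale_law X](mulrN1 s) scale_law_comp sym//.
exact: measurable_preimage.
Qed.

(** This makes the choice of representative in the generalized convolution
    invisible once laws are mixed with [mu]. *)
Lemma scale_mixture_canonical mu lam :
  scale_mixture mu (canonical_law mu lam) ≡μ scale_mixture mu lam.
Proof.
rewrite /canonical_law; case: asboolP => // sym A mA.
transitivity (\int[lam]_s ((fun s => scale_law s mu A) \o abs_real) s)%E.
  by apply: ge0_integral_distribution => //; exact: measurable_scale_law.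
by apply: eq_integral => s _; exact: symmetric_scale_law_norm.
Qed.

(** Mixing with [mu] turns the generalized convolution into the ordinary one
    and commutes with dilations; conversely the law $T_c \lambda$ itself
    witnesses the generalized convolution. *)
Lemma weakly_stable_wrtP mu lam :
  weakly_stable_wrt mu lam <-> strictly_stable (scale_mixture mu lam).
Proof.
have convE a b : convolution (scale_mixture mu (rscale_law a lam))
      (scale_mixture mu (rscale_law b lam)) ≡μ
    convolution (scale_law a (scale_mixture mu lam))
      (scale_law b (scale_mixture mu lam)).
  by apply: convolution_eq; exact: scale_mixture_rscale.
split=> st a b a0 b0; have [c c0] := st a b a0 b0.
- move=> [lam' lamE canE]; exists c => //.
  apply: measure_eq_trans (measure_eq_sym (convE a b)) _.
  apply: measure_eq_trans lamE _.
  apply: measure_eq_trans (measure_eq_sym (scale_mixture_canonical _ _)) _.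
  apply: measure_eq_trans (scale_mixture_eq _ _) _.
    by move=> A mA; rewrite -canE.
  apply: measure_eq_trans (scale_mixture_canonical _ _) _.
  exact: scale_mixture_rscale.
- move=> cE; exists c => //; exists (rscale_law c lam) => //.
  apply: measure_eq_trans (convE a b) _.
  apply: measure_eq_trans cE _.
  exact/measure_eq_sym/scale_mixture_rscale.
Qed.

Section characteristic_function_of_convolution.
Variable f : E -> R.
Hypothesis fU : dual_unit_ball f.
Let mf := functional_measurable fU.

Lemma char_sqnorm_eq mu nu t : mu ≡μ nu ->
  char_sqnorm mu f t = char_sqnorm nu f t.
Proof. by move=> h; rewrite /char_sqnorm /char_re /char_im !(eq_measure_Rintegral _ h). Qed.

Lemma char_sqnorm_scale a mu t :
  char_sqnorm (scale_law a mu) f t = char_sqnorm mu f (a * t).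
Proof.
have re : char_re (scale_law a mu) f t = char_re mu f (a * t).
  rewrite /char_re Rintegral_distribution.
  + by apply: eq_Rintegral => x _; rewrite /mul_banach functionalZ// mulrA (mulrC t).
  + exact: measurable_cos_scaled.
  + apply: (@bounded_integrable _ _ _ _ _ 1); last by move=> x; exact: norm_cos_le1.
    by apply: measurableT_comp => //; exact: measurable_cos_scaled.
have im : char_im (scale_law a mu) f t = char_im mu f (a * t).
  rewrite /char_im Rintegral_distribution.
  + by apply: eq_Rintegral => x _; rewrite /mul_banach functionalZ// mulrA (mulrC t).
  + exact: measurable_sin_scaled.
  + apply: (@bounded_integrable _ _ _ _ _ 1); last by move=> x; exact: norm_sin_le1.
    by apply: measurableT_comp => //; exact: measurable_sin_scaled.
by rewrite /char_sqnorm re im.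
Qed.

Lemma char_sqnorm_convolution mu nu t :
  char_sqnorm (convolution mu nu) f t = char_sqnorm mu f t * char_sqnorm nu f t.
Proof.
have mc := measurable_cos_scaled t mf; have ms := measurable_sin_scaled t mf.
have c1 x := norm_cos_le1 (t * f x); have s1 x := norm_sin_le1 (t * f x).
have [icc ecc] := Rintegral_prod_mul mu nu mc mc c1 c1.
have [iss ess] := Rintegral_prod_mul mu nu ms ms s1 s1.
have [isc esc] := Rintegral_prod_mul mu nu ms mc s1 c1.
have [ics ecs] := Rintegral_prod_mul mu nu mc ms c1 s1.
have re : char_re (convolution mu nu) f t =
    char_re mu f t * char_re nu f t - char_im mu f t * char_im nu f t.
  rewrite /char_re /char_im Rintegral_distribution => //; last first.
    apply: (@bounded_integrable _ _ _ _ _ 1); last by move=> x; exact: norm_cos_le1.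
    by apply: measurableT_comp => //.
  rewrite -ecc -ess -RintegralB//; apply: eq_Rintegral => z _.
  by rewrite /add_banach functionalD// mulrDr cosD.
have im : char_im (convolution mu nu) f t =
    char_im mu f t * char_re nu f t + char_re mu f t * char_im nu f t.
  rewrite /char_re /char_im Rintegral_distribution => //; last first.
    apply: (@bounded_integrable _ _ _ _ _ 1); last by move=> x; exact: norm_sin_le1.
    by apply: measurableT_comp => //.
  rewrite -esc -ecs -RintegralD//; apply: eq_Rintegral => z _.
  by rewrite /add_banach functionalD// mulrDr sinD.
by rewrite /char_sqnorm re im; ring.
Qed.

Lemma strictly_stable_char mu a b c :
  convolution (scale_law a mu) (scale_law b mu) ≡μ scale_law c mu ->
  forall t, char_sqnorm mu f (c * t) =
    char_sqnorm mu f (a * t) * char_sqnorm mu f (b * t).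
Proof.
by move=> h t; rewrite -!char_sqnorm_scale -char_sqnorm_convolution; apply/esym/char_sqnorm_eq.
Qed.

(** The dilation factor of the image law under [f] determines that of [nu]. *)
Lemma strictly_stable_nondegenerate nu t0 :
  strictly_stable nu -> char_sqnorm nu f t0 != 1 ->
  exists alpha : R, 0 < alpha <= 2 /\ strictly_alpha_stable alpha nu.
Proof.
move=> st nu1.
have [|||alpha [alpha02 alphaE]] :=
    @stable_modulus_index R (char_sqnorm nu f) t0 (char_sqnorm_continuous mf)
      (char_sqnorm0 nu f) (char_sqnorm_ge0 nu f) (char_sqnorm_le1 nu mf) _ _ _.
- by rewrite lt_neqAle nu1 char_sqnorm_le1.
- move=> a b a0 b0; have [c c0 cE] := st a b a0 b0.
  by exists c => //; exact: strictly_stable_char.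
- exact: char_sqnorm_double.
exists alpha; split=> // a b a0 b0; have [c c0 cE] := st a b a0 b0.
by rewrite -(alphaE a b c a0 b0 c0 (strictly_stable_char cE)).
Qed.

End characteristic_function_of_convolution.

(** Some quotient of [u] by a positive integer lies in $[-1, 1]$, where the
    cosine takes the value 1 only at 0. *)
Lemma cos_quotients_eq1 (u : R) : (forall k : nat, cos (k.+1%:R^-1 * u) = 1) -> u = 0.
Proof.
move=> h; pose k := Num.trunc `|u|.
have k0 : 0 < k.+1%:R :> R by rewrite ltr0n.
have uk : `|k.+1%:R^-1 * u| <= 1.
  rewrite normrM gtr0_norm ?invr_gt0// ler_pdivrMl// mulr1 ltW//.
  exact: truncnS_gt.
have pi1 : 1 <= pi :> R by apply: le_trans (pi_ge2 R); rewrite ler1n.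
have : `|k.+1%:R^-1 * u| = 0.
  apply: cos_inj; rewrite ?in_itv/= ?normr_ge0 ?lexx ?pi_ge0 ?(le_trans uk)//.
  by rewrite cos_norm h cos0.
by move/eqP; rewrite normr_eq0 mulf_eq0 invr_eq0 (gt_eqF k0)/= => /eqP.
Qed.

(** For the times $1/(k+1)$ and the functionals $f_n$, almost every point gives
    $e^{i f_n(x)/(k+1)}$ its mean value; any two such points $x, x_0$ satisfy
    $f_n(x - x_0) = 0$ for all $n$. Only countably many null sets are discarded. *)
Lemma degenerate_dirac nu (f : nat -> E -> R) :
  (forall n, dual_unit_ball (f n)) -> (forall x, (forall n, f n x = 0) -> x = 0) ->
  (forall n t, char_sqnorm nu (f n) t = 1) ->
  exists x0 : borel E, nu ≡μ @dirac _ (borel E) x0 R.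
Proof.
move=> fU fsep f1.
pose Q (x : borel E) := forall n k : nat,
  cos (k.+1%:R^-1 * f n x) = char_re nu (f n) k.+1%:R^-1 /\
  sin (k.+1%:R^-1 * f n x) = char_im nu (f n) k.+1%:R^-1.
have aeQ : {ae nu, forall x, Q x}.
  apply: ae_foralln => n; apply: ae_foralln => k.
  by apply: char_sqnorm_eq1 => //; exact: functional_measurable.
have [x0 Qx0] : exists x0, Q x0.
  have nuT : (0 < nu setT)%E.
    by apply: (@lt_le_trans _ _ 1%E); [exact: lte01|rewrite -(probability_setT nu)].
  have PF := ae_properfilter_algebraOfSetsType nuT.
  exact: filter_ex aeQ.
exists x0; apply: ae_eq_point_dirac; apply: filterS aeQ => x Qx.
apply/eqP; rewrite -subr_eq0; apply/eqP; apply: (fsep (x - x0)) => n.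
apply: cos_quotients_eq1 => k; have [c s] := Qx n k; have [c0 s0] := Qx0 n k.
rewrite (functionalB (fU n)) mulrBr cosB c s -c0 -s0.
by rewrite -!expr2 cos2Dsin2.
Qed.

Lemma convolution_dirac (x y : borel E) :
  convolution (@dirac _ (borel E) x R) (@dirac _ (borel E) y R) ≡μ
  @dirac _ (borel E) (add_banach (x, y)) R.
Proof.
move=> A mA; pose B : set (borel E * borel E) := @add_banach R E @^-1` A.
transitivity (\int[@dirac _ (borel E) x R]_z
    (@dirac _ (borel E) y R \o xsection B) z)%E; first by [].
rewrite integral_dirac//; last first.
  by apply: measurable_fun_xsection; exact: measurable_preimage.
rewrite /= diracT mul1e; congr ((nat_of_bool _)%:R%:E).
by apply/idP/idP; rewrite !inE /xsection/= !inE.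
Qed.

Lemma dirac_strictly_1_stable nu (x0 : borel E) : nu ≡μ @dirac _ (borel E) x0 R ->
  strictly_alpha_stable 1 nu.
Proof.
move=> nux a b a0 b0.
have sc c : scale_law c nu ≡μ @dirac _ (borel E) (mul_banach c x0) R.
  move=> A mA; transitivity (scale_law c (@dirac _ (borel E) x0 R) A).
    exact: scale_law_eq.
  by congr ((nat_of_bool _)%:R%:E); apply/idP/idP; rewrite !inE.
rewrite invr1 !powRr1 ?addr_ge0 ?ltW//.
apply: measure_eq_trans (convolution_eq (sc a) (sc b)) _.
apply: measure_eq_trans (convolution_dirac _ _) (measure_eq_sym _).
apply: measure_eq_trans (sc _) _ => A mA.
by rewrite /mul_banach /add_banach scalerDl.
Qed.

Lemma strictly_stable_index nu : strictly_stable nu ->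
  exists alpha : R, 0 < alpha <= 2 /\ strictly_alpha_stable alpha nu.
Proof.
move=> st; have [f [fU fsep]] := @separating_sequence R E.
have [deg|] := pselect (forall n t, char_sqnorm nu (f n) t = 1).
  have [x0 nux0] := degenerate_dirac fU fsep deg.
  exists 1; split; first by rewrite ltr01 ler1n.
  exact: dirac_strictly_1_stable nux0.
move=> /existsNP[n /existsNP[t /eqP nt]].
exact: (strictly_stable_nondegenerate (fU n) st nt).
Qed.

End laws.

Theorem lemma3 (R : realType) (E : separableBanachType R)
    (mu : probability (borel E) R)
    (mu_ws : weakly_stable mu) (mu_neq0 : ~ (mu ≡μ dirac_zero))
    (lam : probability R R) :
  (weakly_stable_wrt mu lam <-> strictly_stable (scale_mixture mu lam)) /\
  (weakly_stable_wrt mu lam ->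
   exists alpha : R, 0 < alpha <= 2 /\
     strictly_alpha_stable alpha (scale_mixture mu lam)).
Proof.
split; first exact: weakly_stable_wrtP.
by move=> /weakly_stable_wrtP; exact: strictly_stable_index.
Qed.
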